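(* For every cake-division instance with four agents whose social graph is the line $a_1-a_2-a_3-a_4$, there exists a discrete cake-cutting protocol in the Robertson–Webb query model that finds a locally envy-free allocation using $8$ cut queries and $16$ evaluation queries.
   Context: The cake is $[0,1]$. Each agent $a_i$ has a valuation $v_i$ on finite unions of subintervals of $[0,1]$ that is non-negative, additive on disjoint pieces, non-atomic (for any $[x,y]$ and $\lambda\in[0,1]$ there is $y'$ with $v_i(x,y')=\lambda v_i(x,y)$), and normalized ($v_i(0,1)=1$). An allocation is a collection $\{A_1,\dots,A_4\}$ of pairwise disjoint pieces (each a finite union of intervals) whose union is $[0,1]$, with $A_i$ given to $a_i$. It is locally envy-free on the line if $v_i(A_i)\ge v_i(A_j)$ whenever $|i-j|=1$. In the Robertson–Webb query model the protocol accesses valuations only through cut queries $\texttt{cut}_i(x,\tau)$ (returns $y$ with $v_i(x,y)=\tau$) and evaluation queries $\texttt{eval}_i(x,y)$ (returns $v_i(x,y)$). *)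

(* Defs.v *)
From Stdlib Require Import Reals List.
Import ListNotations.
Open Scope R_scope.

Inductive agent : Type := A1 | A2 | A3 | A4.

Definition all_agents : list agent := [A1; A2; A3; A4].

Definition line_adj (i j : agent) : Prop :=
  match i, j with
  | A1, A2 | A2, A1 | A2, A3 | A3, A2 | A3, A4 | A4, A3 => True
  | _, _ => False
  end.

(** A valuation is given by its values on intervals: [v x y] = v([x,y]). *)
Definition interval_val := R -> R -> R.

Definition is_valuation (v : interval_val) : Prop :=
  (forall x y, 0 <= x -> x <= y -> y <= 1 -> 0 <= v x y) /\
  (forall x y z, 0 <= x -> x <= y -> y <= z -> z <= 1 ->
      v x z = v x y + v y z) /\
  (forall x y lam, 0 <= x -> x <= y -> y <= 1 -> 0 <= lam -> lam <= 1 ->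
      exists y', x <= y' /\ y' <= 1 /\ v x y' = lam * v x y) /\
  v 0 1 = 1.

(** A piece is a finite union of intervals [a,b], given as a list. *)
Definition piece := list (R * R).

Definition piece_val (v : interval_val) (P : piece) : R :=
  fold_right (fun ab acc => v (fst ab) (snd ab) + acc) 0 P.

Definition allocation := agent -> piece.

Definition all_intervals (A : allocation) : list (R * R) :=
  concat (map A all_agents).

Definition is_allocation (A : allocation) : Prop :=
  (forall ab, In ab (all_intervals A) ->
      0 <= fst ab /\ fst ab <= snd ab /\ snd ab <= 1) /\
  (forall t, 0 <= t -> t <= 1 ->
      exists i ab, In ab (A i) /\ fst ab <= t /\ t <= snd ab) /\
  (forall m n, (m < length (all_intervals A))%nat ->
      (n < length (all_intervals A))%nat -> m <> n ->
      forall t,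
        ~ (fst (nth m (all_intervals A) (0,0)) < t /\ t < snd (nth m (all_intervals A) (0,0)) /\
           fst (nth n (all_intervals A) (0,0)) < t /\ t < snd (nth n (all_intervals A) (0,0)))).

Definition instance := agent -> interval_val.

Definition locally_envy_free_line (v : instance) (A : allocation) : Prop :=
  forall i j, line_adj i j -> piece_val (v i) (A i) >= piece_val (v i) (A j).

(** Protocols in the Robertson-Webb query model: decision trees whose
    next step may depend (arbitrarily) on the answers received so far. *)
Inductive protocol : Type :=
| Cut   (i : agent) (x tau : R) (k : R -> protocol)
| Eval  (i : agent) (x y : R) (k : R -> protocol)
| Output (A : allocation).

(** [succeeds v p nc ne]: on instance v, every execution of p (for every
    admissible answer to each cut query) issues only answerable queries,
    uses at most nc cut queries and ne evaluation queries, and outputs a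
    locally envy-free allocation. *)
Inductive succeeds (v : instance) : protocol -> nat -> nat -> Prop :=
| succ_output : forall A nc ne,
    is_allocation A -> locally_envy_free_line v A ->
    succeeds v (Output A) nc ne
| succ_cut : forall i x tau k nc ne,
    0 <= x -> x <= 1 ->
    (exists y, x <= y /\ y <= 1 /\ v i x y = tau) ->
    (forall y, x <= y -> y <= 1 -> v i x y = tau -> succeeds v (k y) nc ne) ->
    succeeds v (Cut i x tau k) (S nc) ne
| succ_eval : forall i x y k nc ne,
    0 <= x -> x <= y -> y <= 1 ->
    succeeds v (k (v i x y)) nc ne ->
    succeeds v (Eval i x y k) nc (S ne).

(* Main.v *)
(** Agent 2 cuts the cake into quarters.  Agent 3 ranks them as
    [P >= B >= C, D], trims [P] to a piece [P'] that it values like [B], and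
    leaves the trimmings [T].  Agent 2 quarters [T]; agent 3 ranks the quarters
    as [X >= Y >= U, V] and moves a right end [X''] from [X] to [Y] so that it
    values [X' = X \ X''] and [Y + X''] equally.  Consider the four bundles
    [B + X'], [P' + Y + X''], [C + U] and [D + V].  Agent 3 is indifferent
    between the first two and weakly prefers them to the others.  Agent 2 is
    indifferent between the last two and weakly prefers them to the others,
    since [X'] lies in [X] and [P' + Y + X''] lies in [P].  So agent 4 may choose among the
    first two bundles and agent 1 among the last two, leaving the remaining
    ones to agents 3 and 2. *)

Require Import Defs.
From Stdlib Require Import Reals List.
From Stdlib Require Import Lra Lia Permutation Sorting Orders.
Import ListNotations.

(** * Values of intervals *)

Definition interval_value (v : interval_val) (p : R * R) : R := v (fst p) (snd p).

Section Valuation.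
Variables (v : interval_val) (Hv : is_valuation v).

Lemma valuation_ge0 x y : 0 <= x -> x <= y -> y <= 1 -> 0 <= v x y.
Proof. apply Hv. Qed.

Lemma valuation_add x y z :
  0 <= x -> x <= y -> y <= z -> z <= 1 -> v x z = v x y + v y z.
Proof. apply Hv. Qed.

Lemma valuation_add4 a x y z b :
  0 <= a -> a <= x <= y -> y <= z <= b -> b <= 1 ->
  v a b = interval_value v (a, x) + interval_value v (x, y)
          + interval_value v (y, z) + interval_value v (z, b).
Proof.
  intros Ha Hx Hz Hb. unfold interval_value; simpl.
  rewrite (valuation_add a x b), (valuation_add x y b), (valuation_add y z b); lra.
Qed.

Lemma valuation_whole : v 0 1 = 1.
Proof. apply Hv. Qed.

(** Non-atomicity is stated for fractions of [v x e], so it is applied to the ratio of [tau] to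
    [v x e]. If [v x e] is 0, then so is [tau], and [e] itself serves. The cut point is bounded by
    1, not by [e]. *)
Lemma valuation_cut_exists x e tau :
  0 <= x -> x <= e -> e <= 1 -> 0 <= tau <= v x e ->
  exists y, x <= y /\ y <= 1 /\ v x y = tau.
Proof.
  intros Hx Hxe He Htau.
  destruct (Req_dec (v x e) 0) as [H0 | Hn0].
  - exists e. lra.
  - destruct Hv as (_ & _ & Hcut & _).
    destruct (Hcut x e (tau / v x e)) as (y & Hxy & Hy & E); try lra.
    + apply Rmult_le_pos; [lra | left; apply Rinv_0_lt_compat; lra].
    + apply Rmult_le_reg_r with (v x e); [lra |].
      unfold Rdiv. rewrite Rmult_assoc, Rinv_l by lra. lra.
    + exists y. repeat split; trivial. rewrite E. field. trivial.
Qed.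

End Valuation.

Ltac forall_lra := repeat (apply Forall_cons; [simpl; lra |]); try apply Forall_nil.

Ltac inv_Forall :=
  repeat match goal with
  | H : Forall _ (_ :: _) |- _ => inversion H; subst; clear H
  | H : Forall _ [] |- _ => clear H
  end.

(** * Tilings *)

Definition interior_disjoint (p q : R * R) : Prop :=
  forall t, ~ (fst p < t /\ t < snd p /\ fst q < t /\ t < snd q).

(** Only interiors are disjoint, so endpoints are shared and degenerate intervals are harmless. All
    three clauses survive permutation, so any interval can be brought to the head and split
    there. *)
Definition tiling (a b : R) (l : list (R * R)) : Prop :=
  Forall (fun p => a <= fst p <= snd p /\ snd p <= b) l /\
  (forall t, a <= t <= b -> Exists (fun p => fst p <= t <= snd p) l) /\
  ForallOrdPairs interior_disjoint l.

Lemma ForallOrdPairs_perm (A : Type) (r : A -> A -> Prop) (l l' : list A) :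
  (forall x y, r x y -> r y x) ->
  Permutation l l' -> ForallOrdPairs r l -> ForallOrdPairs r l'.
Proof.
  intros Hsym Hp. induction Hp as [| x l l' Hp IH | x y l | l l' l'' _ IH1 _ IH2];
    intros H; auto.
  - inversion H; subst. constructor; auto. eapply Permutation_Forall; eauto.
  - inversion H as [| ? ? Hy H']; subst. inversion H' as [| ? ? Hx Hl]; subst.
    inversion Hy; subst. repeat constructor; auto.
Qed.

Lemma ForallOrdPairs_nth (A : Type) (r : A -> A -> Prop) (d : A) (l : list A) m n :
  ForallOrdPairs r l -> (m < n < length l)%nat -> r (nth m l d) (nth n l d).
Proof.
  intros H. revert m n. induction H as [| x l Hx _ IH]; simpl; intros m n Hmn; [lia |].
  destruct n as [| n]; [lia |]. destruct m as [| m].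
  - rewrite Forall_forall in Hx. apply Hx, nth_In. lia.
  - apply IH. lia.
Qed.

Lemma interior_disjoint_sym p q : interior_disjoint p q -> interior_disjoint q p.
Proof. intros H t Ht. apply (H t). tauto. Qed.

Lemma tiling_perm a b l l' : Permutation l l' -> tiling a b l -> tiling a b l'.
Proof.
  intros Hp (Hwf & Hcov & Hdis). split; [| split].
  - eapply Permutation_Forall; eauto.
  - intros t Ht. eapply Permutation_Exists; eauto.
  - eapply ForallOrdPairs_perm; eauto using interior_disjoint_sym.
Qed.

Lemma tiling_single a b : a <= b -> tiling a b [(a, b)].
Proof.
  intros H. split; [| split].
  - forall_lra.
  - intros t Ht. left. exact Ht.
  - repeat constructor.
Qed.

Lemma tiling_split a b c m d l :
  c <= m <= d -> tiling a b ((c, d) :: l) -> tiling a b ((c, m) :: (m, d) :: l).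
Proof.
  intros Hm (Hwf & Hcov & Hdis).
  inversion Hwf as [| ? ? H1 H2]; subst; simpl in *.
  inversion Hdis as [| ? ? H3 H4]; subst.
  split; [| split].
  - forall_lra. trivial.
  - intros t Ht. specialize (Hcov t Ht). apply Exists_cons in Hcov.
    destruct Hcov as [Hcd | Hl]; simpl in *; auto.
    destruct (Rle_dec t m); [left | right; left]; simpl; lra.
  - repeat constructor; trivial.
    + intros t; simpl; lra.
    + eapply Forall_impl; [| exact H3]. intros q Hq t Ht.
      apply (Hq t). simpl in *. lra.
    + eapply Forall_impl; [| exact H3]. intros q Hq t Ht.
      apply (Hq t). simpl in *. lra.
Qed.

Lemma tiling_quarter a b c x y z d l :
  c <= x <= y -> y <= z <= d -> tiling a b ((c, d) :: l) ->
  tiling a b ((c, x) :: (x, y) :: (y, z) :: (z, d) :: l).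
Proof.
  intros Hx Hz H.
  apply tiling_split; [lra |]. apply tiling_split; [lra |]. apply tiling_split; [lra | trivial].
Qed.

Lemma tiling_allocation A l :
  tiling 0 1 l -> Permutation l (all_intervals A) -> is_allocation A.
Proof.
  intros Ht Hp. apply (tiling_perm _ _ _ _ Hp) in Ht.
  destruct Ht as (Hwf & Hcov & Hdis). split; [| split].
  - rewrite Forall_forall in Hwf. intros ab Hab. specialize (Hwf ab Hab). lra.
  - intros t H0 H1. specialize (Hcov t (conj H0 H1)).
    apply Exists_exists in Hcov. destruct Hcov as (ab & Hin & Hab).
    unfold all_intervals in Hin. apply in_concat in Hin.
    destruct Hin as (P & HP & Hin). apply in_map_iff in HP.
    destruct HP as (i & <- & _). exists i, ab. tauto.
  - intros m n Hm Hn Hmn t Ht.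
    destruct (Nat.lt_total m n) as [H | [H | H]]; [| lia |].
    + apply (ForallOrdPairs_nth _ _ (0, 0) _ m n Hdis) with t; [lia | tauto].
    + apply (ForallOrdPairs_nth _ _ (0, 0) _ n m Hdis) with t; [lia | tauto].
Qed.

(** * Subprotocols *)

(** A cut query may answer with a point beyond [e] when the agent attaches no
    value to the cake just after [e]; clamping repairs this. *)
Definition cut_within (i : agent) (x e tau : R) (k : R -> protocol) : protocol :=
  Cut i x tau (fun y => k (Rmin y e)).

Definition quarter (i : agent) (a b s : R) (k : R -> R -> R -> protocol) : protocol :=
  cut_within i a b (s / 4) (fun x =>
  cut_within i x b (s / 4) (fun y =>
  cut_within i y b (s / 4) (fun z => k x y z))).

Module DecreasingValue <: TotalLeBool.
  Definition t := ((R * R) * R)%type.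
  Definition leb (x y : t) : bool := if Rle_dec (snd y) (snd x) then true else false.
  Lemma leb_total x y : leb x y = true \/ leb y x = true.
  Proof.
    unfold leb. destruct (Rle_dec (snd y) (snd x)), (Rle_dec (snd x) (snd y)); auto; lra.
  Qed.
End DecreasingValue.

Module ValueSort := Sort DecreasingValue.

(** The value of [p4] is deduced from the total value [s] of the four
    intervals.  The continuation receives the intervals in order of decreasing
    value, followed by the values of the first two. *)
Definition rank (i : agent) (p1 p2 p3 p4 : R * R) (s : R)
  (k : R * R -> R * R -> R * R -> R * R -> R -> R -> protocol) : protocol :=
  (Eval i (fst p1) (snd p1) (fun x1 =>
  Eval i (fst p2) (snd p2) (fun x2 =>
  Eval i (fst p3) (snd p3) (fun x3 =>
  match ValueSort.sort [(p1, x1); (p2, x2); (p3, x3); (p4, s - x1 - x2 - x3)] with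
  | [(q1, y1); (q2, y2); (q3, _); (q4, _)] => k q1 q2 q3 q4 y1 y2
  | _ => Output (fun _ => [])
  end)))).

Fixpoint eval_piece (i : agent) (P : piece) (k : R -> protocol) : protocol :=
  match P with
  | [] => k 0
  | (x, y) :: P' => Eval i x y (fun a => eval_piece i P' (fun s => k (a + s)))
  end.

Definition choose (i : agent) (P Q : piece) (k : piece -> piece -> protocol) : protocol :=
  eval_piece i P (fun s => eval_piece i Q (fun s' =>
    if Rle_dec s' s then k P Q else k Q P)).

Section Subprotocols.
Variables (v : instance) (Hv : forall i, is_valuation (v i)).

Lemma succeeds_cut_within i x e tau k nc ne :
  0 <= x -> x <= e -> e <= 1 -> 0 <= tau <= v i x e ->
  (forall y, x <= y -> y <= e -> v i x y = tau -> v i y e = v i x e - tau ->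
    succeeds v (k y) nc ne) ->
  succeeds v (cut_within i x e tau k) (S nc) ne.
Proof.
  intros Hx Hxe He Htau Hk. apply succ_cut; try lra.
  - eapply valuation_cut_exists; eauto.
  - intros y Hxy Hy1 E. destruct (Rle_dec y e) as [Hye | Hye].
    + rewrite Rmin_left by lra. apply Hk; trivial.
      pose proof (valuation_add _ (Hv i) x y e). lra.
    + rewrite Rmin_right by lra.
      (* Here [v i x y = tau <= v i x e] and [v i e y >= 0] force [v i x e = tau], so [e] is a
         correct cut point; additivity at [e] also gives [v i e e = 0]. *)
      pose proof (valuation_add _ (Hv i) x e y).
      pose proof (valuation_ge0 _ (Hv i) e y).
      pose proof (valuation_add _ (Hv i) x e e).
      apply Hk; lra.
Qed.

Lemma succeeds_quarter i a b s k nc ne :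
  0 <= a -> a <= b -> b <= 1 -> s = v i a b ->
  (forall x y z, a <= x <= y -> y <= z <= b ->
    Forall (fun p => interval_value (v i) p = s / 4) [(a, x); (x, y); (y, z); (z, b)] ->
    succeeds v (k x y z) nc ne) ->
  succeeds v (quarter i a b s k) (S (S (S nc))) ne.
Proof.
  intros Ha Hab Hb Hs Hk.
  pose proof (valuation_ge0 _ (Hv i) a b Ha Hab Hb).
  apply succeeds_cut_within; try lra. intros x ? ? Ex Ex'.
  apply succeeds_cut_within; try lra. intros y ? ? Ey Ey'.
  apply succeeds_cut_within; try lra. intros z ? ? Ez Ez'.
  apply Hk; try lra. unfold interval_value; forall_lra.
Qed.

Lemma succeeds_rank i p1 p2 p3 p4 s k nc ne :
  Forall (fun p => 0 <= fst p <= snd p /\ snd p <= 1) [p1; p2; p3; p4] ->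
  s = interval_value (v i) p1 + interval_value (v i) p2
      + interval_value (v i) p3 + interval_value (v i) p4 ->
  (forall q1 q2 q3 q4, Permutation [p1; p2; p3; p4] [q1; q2; q3; q4] ->
    interval_value (v i) q2 <= interval_value (v i) q1 ->
    interval_value (v i) q3 <= interval_value (v i) q2 ->
    interval_value (v i) q4 <= interval_value (v i) q2 ->
    succeeds v
      (k q1 q2 q3 q4 (interval_value (v i) q1) (interval_value (v i) q2)) nc ne) ->
  succeeds v (rank i p1 p2 p3 p4 s k) nc (S (S (S ne))).
Proof.
  intros Hwf -> Hk.
  inv_Forall.
  do 3 (apply succ_eval; try lra).
  match goal with |- context [ValueSort.sort ?L] => set (l := L) end.
  assert (Hl : Forall (fun p => snd p = interval_value (v i) (fst p)) l).
  { unfold l, interval_value. forall_lra. }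
  pose proof (ValueSort.Permuted_sort l) as Hp.
  pose proof (ValueSort.LocallySorted_sort l) as Hsort.
  (* Sorting preserves length, so the default output of [rank] is never reached. *)
  destruct (ValueSort.sort l) as [| [q1 y1] [| [q2 y2] [| [q3 y3] [| [q4 y4] [| ? ?]]]]];
    try (apply Permutation_length in Hp; discriminate Hp).
  apply (Permutation_Forall Hp) in Hl.
  inv_Forall.
  repeat match goal with
  | H : LocallySorted _ (_ :: _ :: _) |- _ => inversion H; subst; clear H
  end.
  unfold DecreasingValue.leb, is_true in *. simpl in *. subst.
  repeat match goal with
  | H : context [Rle_dec ?x ?y] |- _ => destruct (Rle_dec x y); [clear H | discriminate H]
  end.
  apply Hk; try lra. exact (Permutation_map fst Hp).
Qed.

Lemma succeeds_eval_piece i P k nc ne :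
  Forall (fun p => 0 <= fst p <= snd p /\ snd p <= 1) P ->
  succeeds v (k (piece_val (v i) P)) nc ne ->
  succeeds v (eval_piece i P k) nc (length P + ne).
Proof.
  intros H. revert k. induction H as [| [x y] P Hp _ IH]; intros k Hk; trivial.
  simpl in *. apply succ_eval; try lra. apply IH, Hk.
Qed.

Lemma succeeds_choose i P Q k nc ne :
  Forall (fun p => 0 <= fst p <= snd p /\ snd p <= 1) (P ++ Q) ->
  (piece_val (v i) Q <= piece_val (v i) P -> succeeds v (k P Q) nc ne) ->
  (piece_val (v i) P <= piece_val (v i) Q -> succeeds v (k Q P) nc ne) ->
  succeeds v (choose i P Q k) nc (length P + (length Q + ne)).
Proof.
  intros H HP HQ. apply Forall_app in H.
  apply succeeds_eval_piece; [tauto |].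
  apply succeeds_eval_piece; [tauto |].
  destruct (Rle_dec _ _); [apply HP | apply HQ]; lra.
Qed.

End Subprotocols.

(** * The protocol *)

Definition assign (P1 P2 P3 P4 : piece) : allocation :=
  fun i => match i with Defs.A1 => P1 | A2 => P2 | A3 => P3 | A4 => P4 end.

(** The cuts number 3 + 1 + 3 + 1 = 8 and the evaluations 3 + 1 + 3 + (2 + 3) + (2 + 2) = 16.
    Cutting [X] at [(vX + vY) / 2] leaves a right end worth [(vX - vY) / 2] to agent 3, which raises
    [Y] to the same value. *)
Definition line_protocol : protocol :=
  quarter A2 0 1 1 (fun c1 c2 c3 =>
  rank A3 (0, c1) (c1, c2) (c2, c3) (c3, 1) 1 (fun P B C D vP vB =>
  cut_within A3 (fst P) (snd P) vB (fun m =>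
  Eval A2 m (snd P) (fun s =>
  quarter A2 m (snd P) s (fun t1 t2 t3 =>
  rank A3 (m, t1) (t1, t2) (t2, t3) (t3, snd P) (vP - vB) (fun X Y U V vX vY =>
  cut_within A3 (fst X) (snd X) ((vX + vY) / 2) (fun w =>
  choose A4 [B; (fst X, w)] [(fst P, m); Y; (w, snd X)] (fun P4 P3 =>
  choose Defs.A1 [C; U] [D; V] (fun P1 P2 =>
  Output (assign P1 P2 P3 P4)))))))))).

(** The final tiling has nine intervals, so the head of the left list is sought at positions 0 to 8
    of the right one. *)
Ltac solve_perm :=
  simpl;
  repeat first
    [ apply perm_nil
    | apply perm_skip
    | apply (Permutation_cons_app [_] _)
    | apply (Permutation_cons_app [_; _] _)
    | apply (Permutation_cons_app [_; _; _] _)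
    | apply (Permutation_cons_app [_; _; _; _] _)
    | apply (Permutation_cons_app [_; _; _; _; _] _)
    | apply (Permutation_cons_app [_; _; _; _; _; _] _)
    | apply (Permutation_cons_app [_; _; _; _; _; _; _] _)
    | apply (Permutation_cons_app [_; _; _; _; _; _; _; _] _)]; simpl.

Theorem theorem5 :
  exists p : protocol,
    forall v : instance,
      (forall i, is_valuation (v i)) ->
      succeeds v p 8 16.
Proof.
  exists line_protocol. intros v Hv.
  apply succeeds_quarter; trivial; try lra.
  { symmetry. apply valuation_whole, Hv. }
  intros c1 c2 c3 Hc Hc' HQ.
  pose proof (tiling_quarter 0 1 0 c1 c2 c3 1 [] Hc Hc'
                (tiling_single 0 1 ltac:(lra))) as HT.
  apply succeeds_rank; trivial.
  { forall_lra. }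
  { transitivity (v A3 0 1).
    - symmetry. apply valuation_whole, Hv.
    - apply valuation_add4; trivial; lra. }
  intros [a b] B C D Hp HB HC HD.
  apply (Permutation_Forall Hp) in HQ. apply (tiling_perm _ _ _ _ Hp) in HT.
  pose proof HT as (Hwf & _). inv_Forall. clear Hp. simpl in *.
  unfold interval_value in HB at 2; simpl in HB.
  pose proof (valuation_ge0 _ (Hv A3) (fst B) (snd B)) as HB0.
  apply succeeds_cut_within; trivial; try (unfold interval_value in *; simpl in *; lra).
  intros m Ham Hmb Em Em'.
  apply succ_eval; try lra.
  apply succeeds_quarter; trivial; try lra.
  intros t1 t2 t3 Ht Ht' HQT.
  assert (HT' : tiling 0 1 [(m, t1); (t1, t2); (t2, t3); (t3, b); (a, m); B; C; D]).
  { apply tiling_quarter; [lra | lra |].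
    eapply tiling_perm; [| apply (tiling_split _ _ a m b); [lra | exact HT]].
    solve_perm. }
  apply succeeds_rank; trivial.
  { forall_lra. }
  (* The trim leaves agent 3 the value [vP - vB] for the trimmings, without a query. *)
  { unfold interval_value at 1; simpl. rewrite <- Em'. apply valuation_add4; trivial; lra. }
  intros [e f] Y U V Hp HY HU HV.
  apply (Permutation_Forall Hp) in HQT.
  apply (tiling_perm _ _ _ _ (Permutation_app_tail _ Hp)) in HT'.
  simpl in HT'. pose proof HT' as (Hwf & _). inv_Forall. clear Hp. simpl in *.
  pose proof (valuation_ge0 _ (Hv A3) (fst Y) (snd Y)) as HY0.
  apply succeeds_cut_within; trivial; try (unfold interval_value in *; simpl in *; lra).
  intros w Hew Hwf Ew Ew'.
  apply (tiling_split _ _ e w f) in HT'; [| lra].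
  (* For agent 2, with trimmings worth [s], these facts give the bundle with [B] at most [1/4 + s/4]
     and the one with [(a, m)] at most [1/4 - s/2], against exactly [1/4 + s/4] for the other
     two. *)
  pose proof (valuation_add _ (Hv A2) a m b) as add1.
  pose proof (valuation_add _ (Hv A2) e w f) as add2.
  pose proof (valuation_ge0 _ (Hv A2) e w) as pos1.
  pose proof (valuation_ge0 _ (Hv A2) w f) as pos2.
  pose proof (valuation_ge0 _ (Hv A2) m b) as pos3.
  (* Of the nine evaluations left, agent 4 uses five and agent 1 the other four. *)
  apply (succeeds_choose v A4 [B; (e, w)] [(a, m); Y; (w, f)] _ 0 4).
  { forall_lra. }
  all: intros Hchoice4.
  all: apply (succeeds_choose v Defs.A1 [C; U] [D; V] _ 0 0).
  1, 4: forall_lra.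
  (* Agents 1 and 4 each have a single neighbour, who holds the bundle they declined. *)
  all: intros Hchoice1; apply succ_output;
    [ eapply tiling_allocation; [exact HT' |]; unfold all_intervals; solve_perm
    | intros [] [] Hij; try destruct Hij; simpl in *;
      unfold interval_value in *; simpl in *; lra ].
Qed.
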